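(* Let $F$ be a generalized semi-Pareto($p,\alpha,\beta$) distribution function, where $0<p<1$, $\alpha>0$, $\beta>0$. Then $F$ is $N$-min stable (with some constant $c$) if and only if $N$ has the Harris($a,k$) law, with $a=1/p$, $\beta=1/k$ and $c=p^{1/\alpha}$.
   Context: Let $X>0$ be a continuous random variable with distribution function $F$, put $R(x)=1-F(x)$, and let $N>0$ be an integer-valued random variable independent of $X$ with probability generating function $Q(s)$. $F$ is called minimum stable with respect to $N$ ($N$-min stable) if $Q[R(cx)]=R(x)$ for all $x>0$ and some $c>0$; here $c\in(0,1)$, and the $c$ in the claim is the constant in this definition. The distribution function $F$ is generalized semi-Pareto($p,\alpha,\beta$) if $F(x)=1-[1+\psi(x)]^{-\beta}$ for $x>0$, with $\beta>0$, where $\psi$ satisfies $\psi(x)=\psi(p^{1/\alpha}x)/p$ for all $x>0$, with $0<p<1$ and $\alpha>0$. The Harris($a,k$) law, with $a>1$ and $k\in\{1,2,\ldots\}$, is the law with probability generating function $Q(s)=s/[a-(a-1)s^k]^{1/k}$.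
   Formalization: As p is not determined by F, the ''only if'' fails for fixed p and arbitrary c; the claim is proved for c=p^{1/α} with the given p, and for arbitrary c with p replaced by some q such that F is generalized semi-Pareto(q,α,β), a=1/q and c=q^{1/α}. *)

(* Defs.v *)
From HB Require Import structures.
From mathcomp Require Import all_boot all_order all_algebra.
From mathcomp Require Import all_classical all_reals all_analysis.

Set Implicit Arguments.
Unset Strict Implicit.
Unset Printing Implicit Defensive.
Import Order.TTheory GRing.Theory Num.Theory.
Import numFieldNormedType.Exports.
Local Open Scope classical_set_scope.
Local Open Scope ring_scope.

(* The library's [cdf] takes values in the extended reals; it is always
   finite, so nothing is lost by projecting it to R. *)
Definition df (d : measure_display) (T : measurableType d) (R : realType)
    (P : probability T R) (X : {RV P >-> R}) (x : R) : R :=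
  fine (cdf X x).

Definition independent_rvs (d d1 d2 : measure_display) (T : measurableType d)
    (T1 : measurableType d1) (T2 : measurableType d2) (R : realType)
    (P : probability T R) (X : {RV P >-> T1}) (Y : {RV P >-> T2}) : Prop :=
  forall (A : set T1) (B : set T2), measurable A -> measurable B ->
    P (X @^-1` A `&` Y @^-1` B) = (P (X @^-1` A) * P (Y @^-1` B))%E.

(* Only used for s in [0, 1], where the expectation is finite. *)
Definition pgf (d : measure_display) (T : measurableType d) (R : realType)
    (P : probability T R) (N : {RV P >-> nat}) (s : R) : R :=
  fine ('E_P[fun t => s ^+ N t]).

Definition min_stable (d : measure_display) (T : measurableType d)
    (R : realType) (P : probability T R) (N : {RV P >-> nat})
    (F : R -> R) (c : R) : Prop :=
  0 < c < 1 /\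
  forall x : R, 0 < x -> pgf N (1 - F (c * x)) = 1 - F x.

(* [0 < 1 + psi x] only makes the real power meaningful: [powR] takes junk
   values on negative bases. *)
Definition generalized_semi_Pareto (R : realType) (F : R -> R)
    (p alpha beta : R) : Prop :=
  [/\ 0 < p < 1, 0 < alpha, 0 < beta &
    exists psi : R -> R, forall x : R, 0 < x ->
      [/\ 0 < 1 + psi x,
          psi x = psi (p `^ (1 / alpha) * x) / p &
          F x = 1 - (1 + psi x) `^ (- beta)]].

(* A law on the natural numbers is determined by its generating function
   on [0, 1]. *)
Definition Harris_law (d : measure_display) (T : measurableType d)
    (R : realType) (P : probability T R) (N : {RV P >-> nat})
    (a : R) (k : nat) : Prop :=
  [/\ 1 < a, (0 < k)%N &
    forall s : R, 0 <= s <= 1 ->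
      pgf N s = s / (a - (a - 1) * s ^+ k) `^ (1 / k%:R)].

(* Main.v *)
Require Import Defs.
From HB Require Import structures.
From mathcomp Require Import all_boot all_order all_algebra.
From mathcomp Require Import all_classical all_reals all_analysis.
From mathcomp Require Import measurable_realfun ring lra.

Set Implicit Arguments.
Unset Strict Implicit.
Unset Printing Implicit Defensive.
Import Order.TTheory GRing.Theory Num.Theory.
Import numFieldNormedType.Exports.
Local Open Scope classical_set_scope.
Local Open Scope ring_scope.

(** Write [R = (1 + psi)^-beta], [g = p^(1/alpha)] and [p_i] for the
    probability that [N = i], so that [psi (g x) = p psi x] and, since [N > 0],
    [Q s / s -> p_1] as [s -> 0].
    Evaluating [Q (R (c x)) = R x] at [x / g^n] and letting [n -> oo] gives
    [p_1 = (psi (c x) / psi x)^beta] for every [x]; hence [psi (c x) = q psi x]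
    with [q] independent of [x], and monotonicity of [psi] forces
    [q = c^alpha].  So one may assume [c = g].  As [R] takes all values of
    ]0, 1[, the equation then reads
    [Q s = s / (a - (a - 1) s^(1/beta))^beta] with [a = 1 / p], and comparing
    the first non-linear terms at [0] shows that [1 / beta] is an integer.  The
    converse is a direct computation. *)

(** * Generating function of an integer-valued variable *)

Lemma measurable_nat_comp (d : measure_display) (T : measurableType d)
    (R : realType) (P : probability T R) (N : {RV P >-> nat}) (f : nat -> R) :
  measurable_fun setT (fun t => f (N t)).
Proof. by apply: (@measurableT_comp _ _ _ _ _ _ f _ N). Qed.

(** The truncated function is a finite combination of indicators of level sets of [N], so additivity
    over a finite sum suffices. *)
Lemma expectation_nat_trunc (d : measure_display) (T : measurableType d)
    (R : realType) (P : probability T R) (N : {RV P >-> nat}) (f : nat -> R)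
    (n : nat) : (forall i, 0 <= f i) ->
  'E_P[fun t => (if (N t < n)%N then f (N t) else 0)%R]%E =
  (\sum_(i < n) fine (P (N @^-1` [set val i])) * f i)%:E.
Proof.
move=> f_ge0.
have mN A : measurable (N @^-1` A).
  by rewrite -[_ @^-1` _]setTI; exact: measurable_funPT.
rewrite unlock.
under eq_integral => t _.
  rewrite (_ : _%:E =
      \sum_(i < n) (f i * \1_(N @^-1` [set val i]) t)%:E)%E; last first.
    rewrite sumEFin; congr EFin.
    have [Nn|nN] := ltnP (N t) n.
      rewrite (bigD1 (Ordinal Nn))//= indicE mem_set//= mulr1 big1 ?addr0//.
      move=> i /negP iN; rewrite indicE memNset ?mulr0//= => Nti.
      by apply: iN; apply/eqP/val_inj.
    rewrite big1// => i _; rewrite indicE memNset ?mulr0//= => Nti.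
    by move: nN; rewrite Nti leqNgt ltn_ord.
  over.
rewrite ge0_integral_sum//=; last 2 first.
- move=> i; apply/measurable_EFinP; apply: measurable_funM => //.
- by move=> i t _; rewrite lee_fin mulr_ge0.
rewrite -sumEFin; apply: eq_bigr => i _.
under eq_integral do rewrite EFinM.
rewrite ge0_integralZl//; last 2 first.
- by apply/measurable_EFinP; exact: measurable_indic.
- by rewrite lee_fin.
rewrite integral_indic// setIT EFinM fineK 1?muleC//.
exact: fin_num_measure.
Qed.

(** As s^i <= s^n for i >= n, the variable s^N lies between its truncation [w] and [w] plus s^n; no
    infinite series is needed. *)
Lemma pgf_bounds (d : measure_display) (T : measurableType d)
    (R : realType) (P : probability T R) (N : {RV P >-> nat}) (n : nat)
    (s : R) (g := \sum_(i < n) fine (P (N @^-1` [set val i])) * s ^+ i) :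
  0 <= s <= 1 -> g <= pgf N s <= g + s ^+ n.
Proof.
move=> /andP[s0 s1].
have mf (f : nat -> R) := measurable_nat_comp N f.
have sge0 i : 0 <= s ^+ i by rewrite exprn_ge0.
pose v i := s ^+ i; pose w i := if (i < n)%N then s ^+ i else 0.
have gE : 'E_P[w \o N]%E = g%:E := expectation_nat_trunc N n sge0.
have w0 i : 0 <= w i by rewrite /w; case: ifP.
have lo : (g%:E <= 'E_P[v \o N])%E.
  rewrite -gE; apply: expectation_le.
  - exact: mf.
  - exact: mf.
  - by move=> t /=.
  - by move=> t /=.
  - by apply/aeW => t; rewrite /= /w /v; case: ifP.
have up : ('E_P[v \o N] <= (g + s ^+ n)%:E)%E.
  have -> : (g + s ^+ n)%:E = 'E_P[fun t => (w (N t) + s ^+ n)%R]%E.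
    rewrite [in RHS]unlock.
    under eq_integral do rewrite EFinD.
    rewrite ge0_integralD//=; last 3 first.
    - by move=> t _; rewrite lee_fin.
    - by apply/measurable_EFinP; exact: mf.
    - by move=> _ _; rewrite lee_fin.
    rewrite -/(cst _) integral_cst//= [P _]probability_setT mule1 EFinD -gE.
    by rewrite [in LHS]unlock.
  apply: expectation_le.
  - exact: mf.
  - exact: (mf (fun i => w i + s ^+ n)).
  - by move=> t /=.
  - by move=> t /=; rewrite addr_ge0.
  - apply/aeW => t; rewrite /= /v /w; case: ltnP => [_|nN].
      by rewrite lerDl.
    by rewrite add0r; apply: ler_wiXn2l.
(* [fine] would send an infinite expectation to 0, so finiteness comes first. *)
have fin : 'E_P[v \o N]%E \is a fin_num.
  by rewrite fin_numElt (lt_le_trans _ lo) ?ltNyr// (le_lt_trans up) ?ltry.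
by rewrite /pgf -2!lee_fin fineK// lo.
Qed.

Lemma pgf1 (d : measure_display) (T : measurableType d)
    (R : realType) (P : probability T R) (N : {RV P >-> nat}) : pgf N 1 = 1.
Proof.
rewrite /pgf; under [X in expectation _ X]eq_fun do rewrite expr1n.
by rewrite expectation_cst.
Qed.

(** * Positive variables and distribution functions *)

Lemma prob_ae0 (d : measure_display) (T : measurableType d)
    (R : realType) (P : probability T R) (A : set T) : measurable A ->
  {ae P, forall t, ~ A t} -> P A = 0%E.
Proof.
move=> mA A0; apply: measure_negligible => //.
by apply: negligibleS A0 => t At /=; apply.
Qed.

Lemma df_le0 (d : measure_display) (T : measurableType d)
    (R : realType) (P : probability T R) (X : {RV P >-> R}) (x : R) :
  {ae P, forall t, 0 < X t} -> x <= 0 -> df X x = 0.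
Proof.
move=> X_pos x0; rewrite /df /cdf /distribution /= /pushforward.
rewrite prob_ae0//.
  by rewrite -[_ @^-1` _]setTI; exact: measurable_funPT.
apply: filterS X_pos => t Xt /=; rewrite in_itv/= => Xx.
by have := lt_le_trans Xt (le_trans Xx x0); rewrite ltxx.
Qed.

Lemma df_homo (d : measure_display) (T : measurableType d)
    (R : realType) (P : probability T R) (X : {RV P >-> R}) :
  {homo df X : x y / x <= y}.
Proof.
by move=> x y xy; rewrite fine_le ?fin_num_measure// cdf_nondecreasing.
Qed.

Lemma cvg_dfy (d : measure_display) (T : measurableType d)
    (R : realType) (P : probability T R) (X : {RV P >-> R}) :
  df X x @[x --> +oo] --> (1 : R).
Proof. exact/fine_cvg/cvg_cdfy1. Qed.

(* The only trace kept of [Q s] being the power series with coefficients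
   [pr i]: every partial sum, with the error that total mass at most [1]
   allows. *)
Definition gf_bounds (R : realType) (pr : nat -> R) (Q : R -> R) :=
  [/\ pr 0%N = 0, forall i, 0 <= pr i <= 1, Q 1 = 1 &
    forall n s, 0 <= s <= 1 ->
      \sum_(i < n) pr i * s ^+ i <= Q s <= \sum_(i < n) pr i * s ^+ i + s ^+ n].

(** * Real powers and elementary estimates *)

Lemma powRVK (R : realType) (x b : R) : 0 <= x -> b != 0 ->
  (x `^ b) `^ (1 / b) = x.
Proof. by move=> x0 b0; rewrite -powRrM mul1r divff// powRr1. Qed.

Lemma powRNVK (R : realType) (x b : R) : 0 <= x -> b != 0 ->
  (x `^ (- b)) `^ (1 / b) = x^-1.
Proof.
by move=> x0 b0; rewrite -powRrM mul1r mulNr divff// powR_inv1.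
Qed.

(* The Harris transform of [(1 + p v)^-b] is [(1 + v)^-b]. *)
Lemma harris_identity (R : realType) (p v b : R) : 0 < p -> 0 <= v ->
  let w := 1 + p * v in
  w `^ (- b) / (1 / p - (1 / p - 1) * w^-1) `^ b = (1 + v) `^ (- b).
Proof.
move=> p0 v0 w.
have w0 : 0 < w by rewrite /w ltr_pwDl// mulr_ge0// ltW.
have v1 : 0 < 1 + v by rewrite ltr_pwDl.
have -> : 1 / p - (1 / p - 1) * w^-1 = (1 + v) / w.
  by rewrite /w; field; rewrite !gt_eqF.
rewrite powRM ?invr_ge0 ?ltW// -(powR_inv1 (ltW w0)) -powRrM mulN1r.
have wb : w `^ (- b) != 0 by rewrite gt_eqF ?powR_gt0.
by rewrite invfM mulrCA (divff wb) mulr1 powRN.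
Qed.

Lemma powR_gt0_lt1 (R : realType) (x a : R) : 0 < x < 1 -> 0 < a ->
  0 < x `^ a < 1.
Proof.
move=> /andP[x0 x1] a0; rewrite powR_gt0//=.
have -> : 1 = (1 : R) `^ a by rewrite powR1.
by rewrite gt0_ltr_powR ?nnegrE ?ltW.
Qed.

Lemma powR_ltN (R : realType) (b x y : R) : 0 < b -> 0 < x -> x < y ->
  y `^ (- b) < x `^ (- b).
Proof.
move=> b0 x0 xy; have y0 := lt_trans x0 xy.
rewrite !powRN ltf_pV2 ?posrE ?powR_gt0//.
by apply: gt0_ltr_powR; rewrite ?nnegrE ?ltW.
Qed.

Lemma powR_leN (R : realType) (b x y : R) : 0 < b -> 0 < x ->
  x `^ (- b) <= y `^ (- b) -> y <= x.
Proof. by move=> b0 x0; rewrite !leNgt; apply: contra; exact: powR_ltN. Qed.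

Lemma exprn_lt_eps (R : realType) (r e : R) : 0 <= r < 1 -> 0 < e ->
  exists n, r ^+ n < e.
Proof.
move=> /andP[r0 r1] e0.
have /cvgrPdist_lt/(_ _ e0)[n _ Hn] : r ^+ n @[n --> \oo] --> 0.
  by apply: cvg_expr; rewrite ger0_norm.
exists n; have := Hn n (leqnn n).
by rewrite sub0r normrN ger0_norm// exprn_ge0.
Qed.

(** Otherwise s^(y - x) would tend to 0 with [s] and fall below [A / B]. *)
Lemma powR_dominated_le (R : realType) (A B x y : R) : 0 < A -> 0 < B ->
  (forall s, 0 < s < 1 -> A * s `^ x <= B * s `^ y) -> y <= x.
Proof.
move=> A0 B0 H; rewrite leNgt; apply/negP => xy.
have d0 : 0 < y - x by rewrite subr_gt0.
(* [r] lies below both 1 and [A / B], and [s] is chosen so that s^(y - x) = r. *)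
pose r := A / (A + B); pose s := r `^ (1 / (y - x)).
have r0 : 0 < r by rewrite divr_gt0// addr_gt0.
have r1 : r < 1 by rewrite ltr_pdivrMr ?addr_gt0// mul1r ltrDl.
have s0 : 0 < s by rewrite powR_gt0.
have /andP[_ s1] : 0 < s < 1 by rewrite powR_gt0_lt1 ?r0// divr_gt0.
have := H s; rewrite s0 s1 => /(_ isT).
have -> : s `^ y = s `^ x * r.
  have -> : r = s `^ (y - x).
    by rewrite /s -powRrM div1r mulVf ?gt_eqF// powRr1// ltW.
  by rewrite -powRD ?(gt_eqF s0) ?implybT// addrCA subrr addr0.
rewrite mulrCA [A * _]mulrC ler_pM2l ?powR_gt0// leNgt => /negP; apply.
by rewrite /r mulrA ltr_pdivrMr ?addr_gt0// mulrDr [A * B]mulrC ltrDr mulr_gt0.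
Qed.

(** A substitute for the Taylor expansion at 0: with t = -b ln(1 - y), one has b y <= t <= (b / p) y
    and t <= e^t - 1 <= t e^t. *)
Lemma powRNB1_bounds (R : realType) (b p y : R) : 0 < b -> 0 < p ->
  0 <= y -> p <= 1 - y ->
  b * y <= (1 - y) `^ (- b) - 1 <= b / p * expR (b / p) * y.
Proof.
move=> b0 p0 y0 py.
have q0 : 0 < 1 - y := lt_le_trans p0 py.
have p1 : p <= 1 by rewrite (le_trans py)// gerBl.
have -> : (1 - y) `^ (- b) = expR (b * - ln (1 - y)).
  by rewrite /powR gt_eqF// mulNr mulrN.
set t := b * - ln _.
have lo : b * y <= t.
  rewrite ler_pM2l// lerNr -[leRHS]expRK ler_ln ?posrE ?expR_gt0//.
  exact: expR_ge1Dx.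
have up : t <= b / p * y.
  rewrite /t -mulrA ler_pM2l// -lnV ?posrE//.
  rewrite -[leRHS]expRK ler_ln ?posrE ?invr_gt0 ?expR_gt0//.
  apply: le_trans (expR_ge1Dx _).
  have -> : (1 - y)^-1 = 1 + y / (1 - y) by field; rewrite gt_eqF.
  by rewrite lerD2l mulrC ler_wpM2r// lef_pV2 ?posrE.
have t0 : 0 <= t by rewrite (le_trans _ lo)// mulr_ge0// ltW.
apply/andP; split.
  by rewrite lerBrDl (le_trans _ (expR_ge1Dx _))// lerD2l.
have y1 : y <= 1 by rewrite -subr_ge0 ltW.
have tb : t <= b / p.
  by rewrite (le_trans up)// ler_piMr// divr_ge0// ltW.
have -> : b / p * expR (b / p) * y = b / p * y * expR (b / p) by ring.
apply: (@le_trans _ _ (t * expR t)); last first.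
  by apply: ler_pM; rewrite ?expR_ge0 ?ler_expR.
(* Multiplying 1 - t <= e^(-t) by e^t gives e^t - 1 <= t e^t. *)
have := expR_ge1Dx (- t); rewrite expRN => et.
have := ler_wpM2r (expR_ge0 t) et; rewrite mulVf ?gt_eqF ?expR_gt0//.
lra.
Qed.

Lemma powR_cont (R : realType) (b x : R) : 0 < x ->
  {for x, continuous (fun t : R => t `^ b)}.
Proof.
move=> x0; apply: differentiable_continuous.
apply/derivable1_diffP; apply: derivable_powR.
by rewrite in_itv/= x0.
Qed.

Lemma powRVN (R : realType) (x b : R) : 0 <= x -> x^-1 `^ b = x `^ (- b).
Proof. by move=> x0; rewrite -powR_inv1// -powRrM mulN1r. Qed.

(** * Generating functions and [psi] near the origin *)

Lemma gf_slope0 (R : realType) (pr : nat -> R) (Q : R -> R) (s : R) :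
  gf_bounds pr Q -> 0 < s <= 1 -> `|Q s / s - pr 1%N| <= s.
Proof.
case=> pr0 _ _ QB /andP[s0 s1].
have := QB 2%N s; rewrite (ltW s0) s1 => /(_ isT).
rewrite !big_ord_recl big_ord0 /= pr0 mul0r add0r addr0 expr1 => /andP[lo up].
have -> : Q s / s - pr 1%N = (Q s - pr 1%N * s) / s by field; rewrite gt_eqF.
rewrite ger0_norm ?divr_ge0 ?subr_ge0 ?(ltW s0)//.
by rewrite ler_pdivrMr// -expr2 lerBlDl.
Qed.

(** [U] and [V] stand for psi(c x) and psi(x); dividing x by p^(n/alpha) divides both by p^n. Along
    this sequence Q(s)/s has two expressions, whose limits must agree. *)
Lemma gf_min_stable_slope (R : realType) (pr : nat -> R) (Q : R -> R)
    (p b U V : R) : gf_bounds pr Q -> 0 < p < 1 -> 0 < b -> 0 < U -> 0 < V ->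
  (forall n, Q ((1 + U / p ^+ n) `^ (- b)) = (1 + V / p ^+ n) `^ (- b)) ->
  pr 1%N = (U / V) `^ b.
Proof.
move=> QB /andP[p0 p1] b0 U0 V0 QE.
have z0 n : 0 < p ^+ n by rewrite exprn_gt0.
pose A n := (p ^+ n + U) / (p ^+ n + V).
pose s n := (1 + U / p ^+ n) `^ (- b).
have u0 n : 0 < U / p ^+ n by rewrite divr_gt0.
have v0 n : 0 < V / p ^+ n by rewrite divr_gt0.
have s01 n : 0 < s n <= 1.
  rewrite powR_gt0 ?addr_gt0//= -[leRHS](@powRr0 _ (1 + U / p ^+ n)).
  by apply: ler_powR; rewrite ?lerDl ?oppr_le0 ltW.
have z_cvg : p ^+ n @[n --> \oo] --> 0.
  by apply: cvg_expr; rewrite ger0_norm ?ltW.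
(* Dropping the 1 in the base bounds [s n] by the geometric sequence U^(-b) (p^b)^n. *)
have s_cvg : s n @[n --> \oo] --> 0.
  apply: (@squeeze_cvgr _ _ _ _ (fun=> 0)
    (fun n => U `^ (- b) * (p `^ b) ^+ n)).
  - near=> n; rewrite powR_ge0 /=.
    have -> : U `^ (- b) * (p `^ b) ^+ n = (U / p ^+ n) `^ (- b).
      rewrite powRM ?invr_ge0 ?(ltW U0) ?(ltW (z0 _))//; congr *%R.
      rewrite powRVN ?(ltW (z0 _))// opprK.
      by rewrite -!powR_mulrn ?powR_ge0 ?(ltW p0)// powRAC.
    by rewrite ltW// powR_ltN// ltrDr.
  - exact: cvg_cst.
  - rewrite -[X in _ --> X](mulr0 (U `^ (- b))); apply: cvgMr.
    apply: cvg_expr; rewrite ger0_norm ?powR_ge0//.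
    by have /andP[] : 0 < p `^ b < 1 by rewrite powR_gt0_lt1 ?p0.
have ratio n : Q (s n) / s n = A n `^ b.
  have [u1 v1] : 0 <= 1 + U / p ^+ n /\ 0 <= 1 + V / p ^+ n.
    by rewrite !addr_ge0 ?(ltW (u0 _)) ?(ltW (v0 _)).
  rewrite QE /s -powRVN// [X in _ / X]powRN invrK -powRM ?invr_ge0//.
  rewrite /A; congr (_ `^ _).
  by field; rewrite !gt_eqF ?addr_gt0.
have A_cvg : A n @[n --> \oo] --> U / V.
  apply: cvgM.
    by rewrite -[X in _ --> X]add0r; apply: cvgD => //; exact: cvg_cst.
  apply: cvgV; first by rewrite gt_eqF.
  by rewrite -[X in _ --> X]add0r; apply: cvgD => //; exact: cvg_cst.
have Ab_cvg : A n `^ b @[n --> \oo] --> (U / V) `^ b.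
  apply: (@cvg_comp _ _ _ A (fun t => t `^ b) _ _ _ A_cvg).
  by apply: powR_cont; rewrite divr_gt0.
(* By [gf_slope0], the [b]-th power of [A n] is within [s n] of [pr 1]. *)
have Ab_cvg' : A n `^ b @[n --> \oo] --> pr 1%N.
  apply/cvgrPdist_lt => e e0.
  move/cvgrPdist_lt : s_cvg => /(_ _ e0); apply: filterS => n.
  rewrite sub0r normrN => /(le_lt_trans (ler_norm _)); apply: le_lt_trans.
  by rewrite distrC -ratio gf_slope0.
exact: (cvg_unique _ Ab_cvg' Ab_cvg).
Unshelve. all: by end_near. Qed.

(* [psi x / x^alpha] is invariant under [x |-> p^(1/alpha) x], hence bounded
   away from [0] and [oo] near the origin; along the orbit of [x |-> c x] it
   is a geometric progression of ratio [q / c^alpha], which must be [1]. *)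
Lemma scaling_exponent (R : realType) (psi : R -> R) (p alpha c q : R) :
  0 < p < 1 -> 0 < alpha -> 0 < c < 1 -> 0 < q ->
  (forall x, 0 < x -> 0 < psi x) ->
  (forall x y, 0 < x -> x <= y -> psi x <= psi y) ->
  (forall x, 0 < x -> psi (p `^ (1 / alpha) * x) = p * psi x) ->
  (forall x, 0 < x -> psi (c * x) = q * psi x) ->
  q = c `^ alpha.
Proof.
move=> /andP[p0 p1] al0 /andP[c0 c1] q0 psi0 psi_homo psip psic.
pose g := p `^ (1 / alpha).
have g0 : 0 < g by rewrite powR_gt0.
have /andP[_ g1] : 0 < g < 1 by rewrite powR_gt0_lt1 ?p0// divr_gt0.
have gal : g `^ alpha = p.
  by rewrite /g -powRrM div1r mulVf ?gt_eqF// powRr1// ltW.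
(* Serves for both pairs ([g], [p]) and ([c], [q]). *)
have iter a r n : 0 < a -> (forall x, 0 < x -> psi (a * x) = r * psi x) ->
    psi (a ^+ n) = r ^+ n * psi 1.
  move=> a0 H; elim: n => [|n IH]; first by rewrite !expr0 mul1r.
  by rewrite !exprS H ?exprn_gt0// IH mulrA.
have psi1 := psi0 _ ltr01.
have gn n : (g ^+ n) `^ alpha = p ^+ n.
  by rewrite -powR_mulrn ?(ltW g0)// powRAC gal powR_mulrn// ltW.
have bnd x : 0 < x <= 1 ->
    p * psi 1 * x `^ alpha <= psi x <= psi 1 / p * x `^ alpha.
  move=> /andP[x0 x1].
  (* The least exponent brackets [x] as g^(n+1) < x <= g^n. Then psi(x) / psi(1) and x^alpha both
     lie in [p^(n+1), p^n], so they differ by a factor at most 1/p. *)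
  have ex : exists n, g ^+ n < x by apply: exprn_lt_eps; rewrite ?g1 ?ltW.
  case: (ex_minnP ex) => -[|n] ltx minx.
    by move: ltx; rewrite expr0 ltNge x1.
  have xle : x <= g ^+ n.
    by rewrite leNgt; apply/negP => /minx; rewrite ltnn.
  have xa1 : x `^ alpha <= p ^+ n.
    rewrite -gn ge0_ler_powR ?nnegrE ?exprn_ge0//; by rewrite ltW.
  have xa2 : p ^+ n.+1 <= x `^ alpha.
    rewrite -gn ge0_ler_powR ?nnegrE ?exprn_ge0//; by rewrite ltW.
  have lo := psi_homo _ _ (exprn_gt0 n.+1 g0) (ltW ltx).
  have up := psi_homo _ _ x0 xle.
  rewrite !(iter g p) // in lo up.
  apply/andP; split.
    by apply: le_trans lo; rewrite exprS mulrAC ler_pM2r// ler_pM2l.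
  apply: (le_trans up).
  have -> : psi 1 / p * x `^ alpha = p^-1 * x `^ alpha * psi 1 by ring.
  by rewrite ler_pM2r// ler_pdivlMl// -exprS.
have cal : 0 < c `^ alpha by rewrite powR_gt0.
have bndr n : p * (c `^ alpha) ^+ n <= q ^+ n <= (c `^ alpha) ^+ n / p.
  have := bnd (c ^+ n); rewrite exprn_gt0// exprn_ile1 ?(ltW c0) ?(ltW c1)//.
  move=> /(_ isT); rewrite (iter c q)//.
  rewrite -powR_mulrn ?(ltW c0)// powRAC powR_mulrn ?powR_ge0//.
  by rewrite mulrAC ler_pM2r// -mulrA [psi 1 * _]mulrC ler_pM2r//
    [p^-1 * _]mulrC.
(* If the two bases differed, some power of their quotient would fall below [p], against [bndr]. *)
apply/eqP; rewrite eq_le; apply/andP; split; rewrite leNgt; apply/negP => lt.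
  have [n] : exists n, (c `^ alpha / q) ^+ n < p.
    by apply: exprn_lt_eps => //; rewrite divr_ge0 ?(ltW cal) ?(ltW q0)//=
      ltr_pdivrMr// mul1r.
  rewrite expr_div_n ltr_pdivrMr ?exprn_gt0// ltNge.
  by have /andP[_] := bndr n; rewrite ler_pdivlMr// mulrC => ->.
have [n] : exists n, (q / c `^ alpha) ^+ n < p.
  by apply: exprn_lt_eps => //; rewrite divr_ge0 ?(ltW cal) ?(ltW q0)//=
      ltr_pdivrMr// mul1r.
rewrite expr_div_n ltr_pdivrMr ?exprn_gt0// ltNge.
by have /andP[-> _] := bndr n.
Qed.

(* The lowest-order non-linear term of [Q] at [0] is [pr k * s^k] for an
   integer [k >= 2], while that of the Harris function is a multiple of
   [s^(1 + 1/b)]. *)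
Lemma gf_harris_exponent (R : realType) (pr : nat -> R) (Q : R -> R)
    (p b : R) : gf_bounds pr Q -> 0 < p < 1 -> 0 < b -> pr 1%N = p `^ b ->
  (forall s, 0 < s < 1 ->
     Q s = s / (1 / p - (1 / p - 1) * s `^ (1 / b)) `^ b) ->
  exists2 k, (0 < k)%N & b = 1 / k%:R.
Proof.
case=> pr0 prB _ QB /andP[p0 p1] b0 pr1 QE.
(* With [e] the Harris denominator 1/p - (1/p - 1) y becomes (1 - e y) / p; [M] is the upper
   constant of [powRNB1_bounds]. *)
pose e := 1 - p; pose M := b / p * expR (b / p).
have e0 : 0 < e by rewrite subr_gt0.
have pb0 : 0 < p `^ b by rewrite powR_gt0.
have gam0 : 0 < 1 / b by rewrite divr_gt0.
have Qbnd s : 0 < s < 1 ->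
    p `^ b * b * e * s `^ (1 / b) <= Q s / s - p `^ b
      <= p `^ b * M * e * s `^ (1 / b).
  move=> /andP[s0 s1]; rewrite QE ?s0//.
  set y := s `^ (1 / b).
  have /andP[y0 /ltW y1] : 0 < y < 1 by rewrite powR_gt0_lt1 ?s0.
  have ey : p <= 1 - e * y.
    by rewrite lerBrDr -lerBrDl -/e ler_piMr// ltW.
  have ey0 := lt_le_trans p0 ey.
  have -> : 1 / p - (1 / p - 1) * y = (1 - e * y) / p.
    by rewrite /e; field; rewrite gt_eqF.
  have -> : s / ((1 - e * y) / p) `^ b / s - p `^ b =
      p `^ b * ((1 - e * y) `^ (- b) - 1).
    rewrite powRM ?invr_ge0 ?(ltW p0) ?(ltW ey0)// powRVN ?(ltW p0)//.
    rewrite !powRN; field.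
    by rewrite !gt_eqF ?powR_gt0.
  have /andP[lo up] := powRNB1_bounds b0 p0 (mulr_ge0 (ltW e0) (ltW y0)) ey.
  by rewrite -!mulrA !ler_pM2l// !mulrA in lo up *; rewrite lo up.
(* Without such a [k], [QB] would give Q(s)/s - p^b <= s^(n+1) for all n, against the positive lower
   bound in [Qbnd]; s = 1/2 is an arbitrary choice. *)
have exk : exists k, (1 < k)%N && (0 < pr k).
  apply: contrapT => nk.
  have prk0 k : (1 < k)%N -> pr k = 0.
    move=> k1; apply/eqP; apply: contrapT => /negP prk.
    apply: nk; exists k; rewrite k1 lt0r prk.
    by have /andP[] := prB k.
  pose s : R := 2^-1.
  have s0 : 0 < s by rewrite invr_gt0.
  have s1 : s < 1 by rewrite invf_lt1// ltr1n.
  have := Qbnd s; rewrite s0 s1 => /(_ isT)/andP[lo _].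
  have d0 : 0 < Q s / s - p `^ b.
    by rewrite (lt_le_trans _ lo)// !mulr_gt0// powR_gt0.
  have [n ns] : exists n, s ^+ n < Q s / s - p `^ b.
    by apply: exprn_lt_eps => //; rewrite ltW.
  have := QB n.+2 s; rewrite (ltW s0) (ltW s1) => /(_ isT)/andP[_].
  rewrite 2!big_ord_recl big1 => [|i _]; last by rewrite prk0 ?mul0r.
  rewrite /= pr0 mul0r add0r addr0 expr1 pr1 -lerBlDl.
  have -> : Q s - p `^ b * s = (Q s / s - p `^ b) * s by field; rewrite gt_eqF.
  rewrite !exprSr leNgt => /negP; apply.
  by rewrite ltr_pM2r// (le_lt_trans _ ns)// ler_piMr ?exprn_ge0 ?ltW.
case: (ex_minnP exk) => k /andP[k1 prk] mink.
(* For the least [k] the terms below [k] add up to p^b s. The factor 2 collects [pr k <= 1] and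
   s^(k+1) <= s^k; division by [s] lowers the exponent to k - 1. *)
have Qk s : 0 < s < 1 ->
    pr k * s `^ (k.-1)%:R <= Q s / s - p `^ b <= 2 * s `^ (k.-1)%:R.
  move=> /andP[s0 s1]; have := QB k.+1 s; rewrite (ltW s0) (ltW s1) => /(_ isT).
  rewrite big_ord_recr /=.
  have -> : \sum_(i < k) pr i * s ^+ i = p `^ b * s.
    rewrite (bigD1 (Ordinal k1))//= big1 ?addr0 ?expr1 ?pr1//.
    move=> -[[|[|i]] ik]//= _.
      by rewrite pr0 mul0r.
    have /andP[pri _] := prB i.+2.
    move: pri; rewrite le_eqVlt => /predU1P[<-|pri]; first by rewrite mul0r.
    by have := mink i.+2; rewrite pri => /(_ isT); rewrite leqNgt ik.
  have -> : Q s / s - p `^ b = (Q s - p `^ b * s) / s.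
    by field; rewrite gt_eqF.
  rewrite ler_pdivlMr// ler_pdivrMr// powR_mulrn ?(ltW s0)// -!mulrA -!exprSr.
  rewrite prednK ?(ltn_trans _ k1)// => /andP[lo up].
  rewrite lerBrDl lo lerBlDl (le_trans up)//= -addrA lerD2l mulr_natl mulr2n.
  apply: lerD.
    by rewrite ler_piMl ?exprn_ge0 ?(ltW s0)//; have /andP[] := prB k.
  by rewrite ler_wiXn2l ?ltW.
have M0 : 0 < M by rewrite !mulr_gt0 ?invr_gt0 ?expR_gt0.
clearbody M.
exists k.-1; first by rewrite -ltnS prednK// (ltn_trans _ k1).
(* Each lower bound, set against the other upper bound, gives one inequality between 1/b and k -
   1. *)
have le1 : 1 / b <= k.-1%:R.
  apply: (@powR_dominated_le _ (pr k) (p `^ b * M * e)) => //.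
    by rewrite !mulr_gt0.
  move=> s s01; have /andP[lo _] := Qk s s01; have /andP[_ up] := Qbnd s s01.
  exact: le_trans lo up.
have le2 : k.-1%:R <= 1 / b.
  apply: (@powR_dominated_le _ (p `^ b * b * e) 2) => //.
    by rewrite !mulr_gt0.
  move=> s s01; have /andP[_ up] := Qk s s01; have /andP[lo _] := Qbnd s s01.
  exact: le_trans lo up.
have -> : k.-1%:R = 1 / b by apply/eqP; rewrite eq_le le1 le2.
by rewrite !div1r invrK.
Qed.

(** * Semi-Pareto functions with a given [psi] *)

(** The witness [psi] becomes a parameter, so that several lemmas can speak of the same function. *)
Definition semi_Pareto_with (R : realType) (F psi : R -> R)
    (p alpha beta : R) : Prop :=
  forall x : R, 0 < x ->
    [/\ 0 < 1 + psi x, psi x = psi (p `^ (1 / alpha) * x) / p &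
        F x = 1 - (1 + psi x) `^ (- beta)].

(** Monotonicity and psi >= 0 come from [F], since u^(-beta) decreases in u. A zero of [psi] would
    spread by scaling and monotonicity to the whole half-line, making [F] vanish there, against its
    limit 1. *)
Lemma semi_Pareto_psi (R : realType) (F psi : R -> R) (p alpha beta : R) :
  {homo F : x y / x <= y} -> F 0 = 0 -> F x @[x --> +oo] --> (1 : R) ->
  0 < p < 1 -> 0 < alpha -> 0 < beta -> semi_Pareto_with F psi p alpha beta ->
  [/\ forall x, 0 < x -> 0 < psi x,
      forall x y, 0 < x -> x <= y -> psi x <= psi y &
      forall x, 0 < x -> psi (p `^ (1 / alpha) * x) = p * psi x].
Proof.
move=> F_homo F0 F_cvg /andP[p0 p1] al0 be0 sP.
have scal x : 0 < x -> psi (p `^ (1 / alpha) * x) = p * psi x.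
  by move=> /sP[_ -> _]; rewrite [RHS]mulrC divfK// gt_eqF.
have mono x y : 0 < x -> x <= y -> psi x <= psi y.
  move=> x0 xy; have [u0 _ Fx] := sP _ x0.
  have [v0 _ Fy] := sP _ (lt_le_trans x0 xy).
  have := F_homo _ _ xy; rewrite Fx Fy lerD2l lerN2 => /(powR_leN be0 v0).
  by rewrite lerD2l.
have ge0 x : 0 < x -> 0 <= psi x.
  move=> x0; have [u0 _ Fx] := sP _ x0.
  have := F_homo _ _ (ltW x0); rewrite F0 Fx subr_ge0.
  by have := @powR_leN R beta _ 1 be0 u0; rewrite powR1 lerDl; apply.
split=> // x x0; rewrite lt0r ge0// andbT; apply/eqP => psi0.
pose g := p `^ (1 / alpha).
have g0 : 0 < g by rewrite powR_gt0.
have /andP[_ g1] : 0 < g < 1 by rewrite powR_gt0_lt1 ?p0// divr_gt0.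
have psi_g n y : 0 < y -> psi (g ^+ n * y) = p ^+ n * psi y.
  move=> y0; elim: n => [|n IH]; first by rewrite !expr0 !mul1r.
  by rewrite !exprS -!mulrA scal ?mulr_gt0 ?exprn_gt0// IH.
have Fy0 y : 0 < y -> F y = 0.
  (* For [n] with g^n y < x one gets p^n psi(y) <= psi(x) = 0. *)
  move=> y0; have [n] : exists n, g ^+ n < x / y.
    by apply: exprn_lt_eps; rewrite ?g1 ?(ltW g0) ?divr_gt0.
  rewrite ltr_pdivlMr// => /ltW /mono.
  rewrite mulr_gt0 ?exprn_gt0// => /(_ isT); rewrite psi0 psi_g// => le0.
  have /eqP : p ^+ n * psi y = 0.
    by apply/eqP; rewrite eq_le le0 mulr_ge0 ?ge0 ?exprn_ge0// ltW.
  rewrite mulf_eq0 gt_eqF ?exprn_gt0//= => /eqP psiy.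
  by have [_ _ ->] := sP _ y0; rewrite psiy addr0 powR1 subrr.
have F_cvg0 : F x @[x --> +oo] --> (0 : R).
  by apply: cvg_near_cst; near=> y; apply: Fy0.
have : 1 = 0 :> R by exact: (cvg_unique _ F_cvg F_cvg0).
by move/eqP; rewrite oner_eq0.
Unshelve. all: by end_near. Qed.

(** The intermediate value theorem between 0 and a point where [F] exceeds 1 - s. An equation known
    only at values of 1 - F thus reaches all of ]0, 1[. *)
Lemma survival_onto (R : realType) (F : R -> R) (s : R) :
  continuous F -> F 0 = 0 -> F x @[x --> +oo] --> (1 : R) -> 0 < s < 1 ->
  exists2 x, 0 < x & 1 - F x = s.
Proof.
move=> F_cont F0 F_cvg /andP[s0 s1].
have [b [b0 Fb]] : exists b, 0 < b /\ 1 - s < F b.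
  move/cvgrPdist_lt : F_cvg => /(_ _ s0) near_s.
  near (pinfty_nbhs R) => b; exists b; split.
    by near: b; exact: nbhs_pinfty_gt.
  have : `|1 - F b| < s by near: b.
  by move/(le_lt_trans (ler_norm _)); rewrite ltrBlDr ltrBlDl.
have := @IVT R F 0 b (1 - s) (ltW b0).
have s1' : 0 <= 1 - s by rewrite subr_ge0 ltW.
have Fb0 : 0 <= F b := le_trans s1' (ltW Fb).
rewrite F0 min_l// max_r// s1' (ltW Fb).
move=> /(_ (continuous_subspaceT F_cont) isT)[x].
rewrite in_itv/= => /andP[x0 _] Fx; exists x; last by rewrite Fx subKr.
rewrite lt0r x0 andbT; apply/eqP => x00.
by move: Fx; rewrite x00 F0 => /eqP; rewrite lt_eqF// subr_gt0.
Unshelve. all: by end_near. Qed.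

Lemma semi_Pareto_iter (R : realType) (psi : R -> R) (p alpha x : R) (n : nat) :
  0 < p -> 0 < x ->
  (forall x, 0 < x -> psi (p `^ (1 / alpha) * x) = p * psi x) ->
  psi (x / (p `^ (1 / alpha)) ^+ n) = psi x / p ^+ n.
Proof.
move=> p0 x0 scal; have g0 : 0 < p `^ (1 / alpha) by rewrite powR_gt0.
elim: n => [|n IH]; first by rewrite !expr0 !divr1.
have y0 : 0 < x / (p `^ (1 / alpha)) ^+ n.+1 by rewrite divr_gt0 ?exprn_gt0.
have := scal _ y0; rewrite [X in psi X](_ : _ = x / (p `^ (1 / alpha)) ^+ n).
  rewrite IH => pE; apply: (@mulfI _ p); first by rewrite gt_eqF.
  by rewrite -pE exprS; field; rewrite !gt_eqF ?exprn_gt0.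
by rewrite exprS; field; rewrite !gt_eqF ?exprn_gt0.
Qed.

(** [gf_min_stable_slope] along the points x / p^(n/alpha). As [pr 1] is free of [x], so is the
    ratio psi(c x) / psi(x). *)
Lemma semi_Pareto_slope (R : realType) (pr : nat -> R) (Q F psi : R -> R)
    (p alpha beta c x : R) :
  gf_bounds pr Q -> 0 < p < 1 -> 0 < alpha -> 0 < beta ->
  semi_Pareto_with F psi p alpha beta -> (forall x, 0 < x -> 0 < psi x) ->
  (forall x, 0 < x -> psi (p `^ (1 / alpha) * x) = p * psi x) -> 0 < c ->
  (forall x, 0 < x -> Q (1 - F (c * x)) = 1 - F x) ->
  0 < x -> pr 1%N = (psi (c * x) / psi x) `^ beta.
Proof.
move=> QB p01 al0 be0 sP psi0 scal c0 QE x0; have /andP[p0 p1] := p01.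
have cx0 : 0 < c * x by rewrite mulr_gt0.
apply: gf_min_stable_slope QB p01 be0 (psi0 _ cx0) (psi0 _ x0) _ => n.
rewrite -(semi_Pareto_iter n p0 cx0 scal) -(semi_Pareto_iter n p0 x0 scal).
rewrite -mulrA.
have y0 : 0 < x / (p `^ (1 / alpha)) ^+ n.
  by rewrite divr_gt0 ?exprn_gt0 ?powR_gt0.
have := QE _ y0; have [_ _ ->] := sP _ y0.
by have [_ _ ->] := sP _ (mulr_gt0 c0 y0); rewrite !subKr.
Qed.

(** * The equivalence for c = p^(1/alpha), and the reduction to it *)

(** At s = (1 + p psi(x))^(-beta), stability and [harris_identity] give the Harris formula with
    exponent 1/beta, which [gf_harris_exponent] shows to be an integer. *)
Lemma semi_Pareto_Harris (R : realType) (pr : nat -> R) (Q F : R -> R)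
    (p alpha beta : R) :
  {homo F : x y / x <= y} -> continuous F -> F 0 = 0 ->
  F x @[x --> +oo] --> (1 : R) -> gf_bounds pr Q ->
  generalized_semi_Pareto F p alpha beta ->
  (forall x, 0 < x -> Q (1 - F (p `^ (1 / alpha) * x)) = 1 - F x) ->
  exists k, [/\ (0 < k)%N, beta = 1 / k%:R & forall s, 0 <= s <= 1 ->
    Q s = s / (1 / p - (1 / p - 1) * s ^+ k) `^ (1 / k%:R)].
Proof.
move=> F_homo F_cont F0 F_cvg QB [p01 al0 be0 [psi sP]] QE.
have [psi0 mono scal] := semi_Pareto_psi F_homo F0 F_cvg p01 al0 be0 sP.
have /andP[p0 p1] := p01.
have g0 : 0 < p `^ (1 / alpha) by rewrite powR_gt0.
have pr1 : pr 1%N = p `^ beta.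
  rewrite (semi_Pareto_slope QB p01 al0 be0 sP psi0 scal g0 QE ltr01).
  by rewrite scal// mulfK// gt_eqF// psi0.
have QH s : 0 < s < 1 ->
    Q s = s / (1 / p - (1 / p - 1) * s `^ (1 / beta)) `^ beta.
  move=> s01; have [y y0 Fy] := survival_onto F_cont F0 F_cvg s01.
  pose x := y / p `^ (1 / alpha).
  have x0 : 0 < x by rewrite divr_gt0.
  have yE : y = p `^ (1 / alpha) * x by rewrite /x mulrC divfK// gt_eqF.
  have sE : s = (1 + p * psi x) `^ (- beta).
    by rewrite -Fy; have [_ _ ->] := sP _ y0; rewrite subKr yE scal.
  rewrite -{1}Fy yE QE//; have [_ _ ->] := sP _ x0; rewrite subKr.
  rewrite -(harris_identity _ p0 (ltW (psi0 _ x0))) sE powRNVK ?gt_eqF//.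
  by rewrite ltW// addr_gt0// mulr_gt0// psi0.
have [k k0 bk] := gf_harris_exponent QB p01 be0 pr1 QH.
exists k; split=> // s /andP[s0 s1].
have k0' : k%:R != 0 :> R by rewrite pnatr_eq0 -lt0n.
have [pr0 _ Q1 QB'] := QB.
(* The endpoints lie outside [QH]: at 0 the bounds with n = 1 force Q(0) = 0, and Q(1) = 1 is part
   of [gf_bounds]. *)
move: s0; rewrite le_eqVlt => /predU1P[<-|s0].
  rewrite mul0r; have := QB' 1%N 0; rewrite lexx ler01 => /(_ isT).
  rewrite big_ord_recl big_ord0 /= pr0 mul0r !addr0 => H.
  by apply/eqP; rewrite eq_le andbC.
move: s1; rewrite le_eqVlt => /predU1P[->|s1].
  by rewrite Q1 expr1n mulr1 subKr powR1 divr1.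
rewrite QH ?s0// {2}bk; congr (_ / (_ - _ * _) `^ _).
by rewrite bk div1r div1r invrK powR_mulrn// ltW.
Qed.

Lemma Harris_semi_Pareto (R : realType) (Q F : R -> R) (p alpha beta : R)
    (k : nat) :
  {homo F : x y / x <= y} -> F 0 = 0 -> F x @[x --> +oo] --> (1 : R) ->
  generalized_semi_Pareto F p alpha beta -> (0 < k)%N -> beta = 1 / k%:R ->
  (forall s, 0 <= s <= 1 ->
     Q s = s / (1 / p - (1 / p - 1) * s ^+ k) `^ (1 / k%:R)) ->
  forall x, 0 < x -> Q (1 - F (p `^ (1 / alpha) * x)) = 1 - F x.
Proof.
move=> F_homo F0 F_cvg [p01 al0 be0 [psi sP]] k0 bk QH x x0.
have [psi0 mono scal] := semi_Pareto_psi F_homo F0 F_cvg p01 al0 be0 sP.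
have /andP[p0 p1] := p01.
have gx0 : 0 < p `^ (1 / alpha) * x by rewrite mulr_gt0// powR_gt0.
have u0 : 0 < 1 + p * psi x by rewrite addr_gt0// mulr_gt0// psi0.
have FE : 1 - F (p `^ (1 / alpha) * x) = (1 + p * psi x) `^ (- beta).
  by have [_ _ ->] := sP _ gx0; rewrite subKr scal.
(* The Harris formula holds on [0, 1] only, hence the check that 1 - F lies there. *)
rewrite QH; last first.
  have := F_homo _ _ (ltW gx0); rewrite F0 => Fge0.
  by rewrite {1}FE powR_ge0 gerBl.
have [_ _ ->] := sP _ x0; rewrite subKr FE.
rewrite -(harris_identity _ p0 (ltW (psi0 _ x0))) -bk.
congr (_ / (_ - _ * _) `^ _).
have kE : k%:R = 1 / beta by rewrite bk !div1r invrK.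
by rewrite -powR_mulrn ?powR_ge0// kE powRNVK ?gt_eqF// ltW.
Qed.

(** The ratio psi(c x) / psi(x) is a constant q, and [scaling_exponent] gives q = c^alpha. The same
    psi therefore serves for the parameter c^alpha, which may differ from [p]. *)
Lemma semi_Pareto_rescale (R : realType) (pr : nat -> R) (Q F : R -> R)
    (p alpha beta c : R) :
  {homo F : x y / x <= y} -> F 0 = 0 -> F x @[x --> +oo] --> (1 : R) ->
  gf_bounds pr Q -> generalized_semi_Pareto F p alpha beta -> 0 < c < 1 ->
  (forall x, 0 < x -> Q (1 - F (c * x)) = 1 - F x) ->
  generalized_semi_Pareto F (c `^ alpha) alpha beta.
Proof.
move=> F_homo F0 F_cvg QB [p01 al0 be0 [psi sP]] c01 QE.
have [psi0 mono scal] := semi_Pareto_psi F_homo F0 F_cvg p01 al0 be0 sP.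
have /andP[c0 c1] := c01.
pose q := pr 1%N `^ (1 / beta).
have psic x : 0 < x -> psi (c * x) = q * psi x.
  move=> x0; have r0 : 0 < psi (c * x) / psi x.
    by rewrite divr_gt0 ?psi0 ?mulr_gt0.
  rewrite /q (semi_Pareto_slope QB p01 al0 be0 sP psi0 scal c0 QE x0).
  by rewrite powRVK ?gt_eqF ?(ltW r0)// divfK// gt_eqF// psi0.
(* From psi(c) = q psi(1) with both values positive; this rules out [pr 1 = 0]. *)
have q0 : 0 < q.
  by have := psi0 _ (mulr_gt0 c0 ltr01); rewrite psic// pmulr_lgt0// psi0.
have qE := scaling_exponent p01 al0 c01 q0 psi0 mono scal psic.
split=> //; first exact: powR_gt0_lt1.
exists psi => x x0; have [u0 _ Fx] := sP _ x0; split=> //.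
rewrite powRVK ?gt_eqF ?(ltW c0)// psic// -qE mulrC mulKf//.
by rewrite gt_eqF.
Qed.

(** * Return to the random variables *)

Lemma pgf_gf_bounds (d : measure_display) (T : measurableType d)
    (R : realType) (P : probability T R) (N : {RV P >-> nat}) :
  {ae P, forall t, (0 < N t)%N} ->
  gf_bounds (fun i => fine (P (N @^-1` [set i]))) (pgf N).
Proof.
move=> N_pos.
have mN A : measurable (N @^-1` A).
  by rewrite -[_ @^-1` _]setTI; exact: measurable_funPT.
split.
- rewrite prob_ae0//; apply: filterS N_pos => t Nt /= N0.
  by rewrite N0 in Nt.
- move=> i; rewrite fine_ge0//= -lee_fin fineK ?fin_num_measure//.
  exact: probability_le1.
- exact: pgf1.
- by move=> n s; exact: pgf_bounds.
Qed.

Theorem mainTheorem4 (d : measure_display) (T : measurableType d)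
    (R : realType) (P : probability T R)
    (X : {RV P >-> R}) (N : {RV P >-> nat}) (p alpha beta : R)
    (X_pos : {ae P, forall t, 0 < X t})
    (X_cont : continuous (df X))
    (N_pos : {ae P, forall t, (0 < N t)%N})
    (XN_indep : independent_rvs X N)
    (F_gsp : generalized_semi_Pareto (df X) p alpha beta) :
  (min_stable N (df X) (p `^ (1 / alpha)) <->
   exists (a : R) (k : nat),
     [/\ Harris_law N a k, a = 1 / p & beta = 1 / k%:R])
  /\
  (forall c : R,
   min_stable N (df X) c <->
   exists (q a : R) (k : nat),
     [/\ generalized_semi_Pareto (df X) q alpha beta, Harris_law N a k,
         a = 1 / q, beta = 1 / k%:R & c = q `^ (1 / alpha)]).
Proof.
have QB := pgf_gf_bounds N_pos.
have F0 := df_le0 X_pos (lexx 0).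
have F_homo := @df_homo _ _ _ _ X.
have F_cvg := cvg_dfy X.
have fwd q : generalized_semi_Pareto (df X) q alpha beta ->
    min_stable N (df X) (q `^ (1 / alpha)) ->
    exists (a : R) (k : nat),
      [/\ Harris_law N a k, a = 1 / q & beta = 1 / k%:R].
  move=> Fq [_ QE]; have [/andP[q0 q1] _ _ _] := Fq.
  have [k [k0 bk QH]] := semi_Pareto_Harris F_homo X_cont F0 F_cvg QB Fq QE.
  exists (1 / q), k; split=> //; split=> //.
  by rewrite div1r invf_gt1.
have bwd q k : generalized_semi_Pareto (df X) q alpha beta ->
    Harris_law N (1 / q) k -> beta = 1 / k%:R ->
    min_stable N (df X) (q `^ (1 / alpha)).
  move=> Fq [_ k0 QH] bk; have [q01 al0 _ _] := Fq.
  split; first by rewrite powR_gt0_lt1// divr_gt0.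
  exact: Harris_semi_Pareto F_homo F0 F_cvg Fq k0 bk QH.
split.
  split; first exact: fwd.
  by move=> [a [k [NH ap bk]]]; apply: (bwd _ k) => //; rewrite -ap.
move=> c; split; last first.
  by move=> [q [a [k [Fq NH aq bk ->]]]]; apply: (bwd _ k) => //; rewrite -aq.
move=> [c01 QE].
(* An arbitrary [c] is the (1/alpha)-th power of c^alpha, so after rescaling [fwd] applies with q =
   c^alpha. *)
have Fq := semi_Pareto_rescale F_homo F0 F_cvg QB F_gsp c01 QE.
have [_ al0 _ _] := F_gsp.
have cE : c = (c `^ alpha) `^ (1 / alpha).
  by rewrite powRVK ?gt_eqF//; case/andP: c01 => /ltW.
have [a [k [NH aq bk]]] : exists (a : R) (k : nat),
    [/\ Harris_law N a k, a = 1 / c `^ alpha & beta = 1 / k%:R].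
  by apply: fwd => //; rewrite -cE.
by exists (c `^ alpha), a, k.
Qed.
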